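(* Let $G$ be a pattern graph and $b \in\, !(G)$ a $!$-vertex of $G$. Then the $\mathcal G_3$-typed graphs $\mathrm{COPY}_b(G)$, $\mathrm{DROP}_b(G)$ and $\mathrm{KILL}_b(G)$ are all pattern graphs. If we further suppose that $b' \in\, !(G)$ is a $!$-vertex with $B^\uparrow(b)\setminus b = B^\uparrow(b')\setminus b'$ and $B(b) \cap B(b') = \varnothing$, then $\mathrm{MERGE}_{b,b'}(G)$ is also a pattern graph.
   Context: Graphs. $\mathbf{Graph}$ is the category of directed multigraphs: a graph has a set $E$ of edges, a set $V$ of vertices and functions $s,t:E\to V$ (source and target); loops and parallel edges are allowed. If $t(e)=v$ (resp. $s(e)=v$), $e$ is an in-edge (resp. out-edge) of $v$. $\mathrm{succ}(v)$ is the set of targets of out-edges of $v$, and $\mathrm{pred}(v)$ is the set of sources of in-edges of $v$. For a subgraph $H$ of $G$, $G\setminus H$ is the largest subgraph of $G$ disjoint from $H$ (delete all vertices of $H$ and all edges incident to them); $G\setminus b$ for a vertex $b$ means deleting the vertex $b$ and its incident edges. String graphs. $\mathcal G_2$ is the graph with two vertices $\eta$ (node-vertex type) and $\omega$ (wire-vertex type) and exactly three edges: one $\eta\to\omega$, one $\omega\to\eta$, one loop $\omega\to\omega$. A string graph is an object $(G,\tau:G\to\mathcal G_2)$ of the slice category $\mathbf{Graph}/\mathcal G_2$ in which each wire-vertex (a vertex sent to $\omega$) has at most one in-edge and at most one out-edge. $\mathcal G_3$-typed graphs. $\mathcal G_3$ is $\mathcal G_2$ together with a third vertex $!$, a loop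 $!\to !$, one edge $!\to\eta$ and one edge $!\to\omega$. A $\mathcal G_3$-typed graph is an object $(G,\tau)$ of $\mathbf{Graph}/\mathcal G_3$; $\eta(G),\omega(G),!(G)$ denote the sets of vertices of $G$ sent by $\tau$ to $\eta,\omega,!$ (node-vertices, wire-vertices, $!$-vertices). A wire-vertex is an input of $G$ if its only in-edges (if any) are from $!$-vertices, and an output if it has no out-edges; $\mathrm{In}(G)$, $\mathrm{Out}(G)$ are the sets of inputs and outputs. A subgraph $O$ of $G$ is open if $\mathrm{In}(G\setminus O)\subseteq\mathrm{In}(G)$ and $\mathrm{Out}(G\setminus O)\subseteq\mathrm{Out}(G)$. For $b\in\,!(G)$, $B(b)$ is the full subgraph of $G$ with vertex set $\mathrm{succ}(b)$, and $B^\uparrow(b)$ is the full subgraph with vertex set $\mathrm{pred}(b)$. Pattern graphs. A $\mathcal G_3$-typed graph $G$ is a pattern graph if: (1) the full subgraph $\Sigma(G)$ on $\eta(G)\cup\omega(G)$ is a string graph; (2) the full subgraph $\beta(G)$ on $!(G)$ is posetal, i.e. it has at most one edge from any vertex to any other (or to itself) and the relation ''there is an edge from $x$ to $y$'' is a partial order (in particular reflexive, so $b\in B(b)$ and $b \in B^\uparrow(b)$); (3) for all $b\in\,!(G)$, $B(b)$ is an open subgraph of $G$; (4) for all $b,b'\in\,!(G)$, if $b'\in B(b)$ then $B(b')\subseteq B(b)$. Operations. For a pattern graph $G$ and $b\in\,!(G)$: - $\mathrm{COPY}_b(G)$ is the pushout in $\mathbf{Graph}/\mathcal G_3$ of the inclusion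 $G\setminus B(b)\hookrightarrow G$ with itself (two copies of $G$ glued along $G\setminus B(b)$). - $\mathrm{DROP}_b(G):=G\setminus b$. - $\mathrm{KILL}_b(G):=G\setminus B(b)$. - For $b,b'\in\,!(G)$ with $B^\uparrow(b)\setminus b=B^\uparrow(b')\setminus b'$ and $B(b)\cap B(b')=\varnothing$, $\mathrm{MERGE}_{b,b'}(G)$ is the coequaliser in $\mathbf{Graph}/\mathcal G_3$ of $\hat b,\hat b':B^\uparrow(b)\to G$, where $\hat b$ is the inclusion and $\hat b'$ is the composite of the obvious isomorphism $B^\uparrow(b)\cong B^\uparrow(b')$ (sending $b$ to $b'$ and being the identity on $B^\uparrow(b)\setminus b$) with the inclusion $B^\uparrow(b')\hookrightarrow G$. *)

(* Defs.v *)
From Stdlib Require Import Relations Classical ClassicalEpsilon.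
From Stdlib Require Import FunctionalExtensionality PropExtensionality.

Set Implicit Arguments.
Unset Strict Implicit.

Record graph := Graph {
  vert : Type;
  edge : Type;
  src : edge -> vert;
  tgt : edge -> vert }.

Arguments src {g} e.
Arguments tgt {g} e.

Record hom (G H : graph) := Hom {
  onV : vert G -> vert H;
  onE : edge G -> edge H;
  hom_src : forall e, src (onE e) = onV (src e);
  hom_tgt : forall e, tgt (onE e) = onV (tgt e) }.

Definition hom_eq (G H : graph) (f g : hom G H) : Prop :=
  (forall v, onV f v = onV g v) /\ (forall e, onE f e = onE g e).

Definition hom_id (G : graph) : hom G G :=
  @Hom G G (fun v => v) (fun e => e) (fun _ => eq_refl) (fun _ => eq_refl).

Definition hom_comp (G H K : graph) (g : hom H K) (f : hom G H) : hom G K :=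
  @Hom G K (fun v => onV g (onV f v)) (fun e => onE g (onE f e))
    (fun e => eq_trans (hom_src g (onE f e)) (f_equal (onV g) (hom_src f e)))
    (fun e => eq_trans (hom_tgt g (onE f e)) (f_equal (onV g) (hom_tgt f e))).

Record over (T : graph) := Over {
  carrier :> graph;
  typ : hom carrier T }.

Record ohom (T : graph) (X Y : over T) := OHom {
  under :> hom X Y;
  ohom_typ : hom_eq (hom_comp (typ Y) under) (typ X) }.

Lemma hom_eq_refl (G H : graph) (f : hom G H) : hom_eq f f.
Proof. split; reflexivity. Qed.

Definition ohom_id (T : graph) (X : over T) : ohom X X :=
  @OHom T X X (hom_id X) (hom_eq_refl (typ X)).

Lemma ohom_comp_typ (T : graph) (X Y Z : over T) (g : ohom Y Z) (f : ohom X Y) :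
  hom_eq (hom_comp (typ Z) (hom_comp g f)) (typ X).
Proof.
  destruct f as [f [fV fE]], g as [g [gV gE]]; simpl in *.
  split; intro x; simpl; [rewrite gV; apply fV | rewrite gE; apply fE].
Qed.

Definition ohom_comp (T : graph) (X Y Z : over T) (g : ohom Y Z) (f : ohom X Y) :
  ohom X Z := OHom (ohom_comp_typ g f).

Definition is_iso (T : graph) (X Y : over T) (f : ohom X Y) : Prop :=
  exists g : ohom Y X,
    hom_eq (ohom_comp g f) (ohom_id X) /\ hom_eq (ohom_comp f g) (ohom_id Y).

Definition is_pushout (T : graph) (A X Y P : over T)
    (f : ohom A X) (g : ohom A Y) (i : ohom X P) (j : ohom Y P) : Prop :=
  hom_eq (ohom_comp i f) (ohom_comp j g) /\
  forall (Z : over T) (h : ohom X Z) (k : ohom Y Z),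
    hom_eq (ohom_comp h f) (ohom_comp k g) ->
    exists u : ohom P Z,
      (hom_eq (ohom_comp u i) h /\ hom_eq (ohom_comp u j) k) /\
      forall u' : ohom P Z,
        hom_eq (ohom_comp u' i) h -> hom_eq (ohom_comp u' j) k -> hom_eq u' u.

Definition is_coequaliser (T : graph) (A X Q : over T)
    (f g : ohom A X) (q : ohom X Q) : Prop :=
  hom_eq (ohom_comp q f) (ohom_comp q g) /\
  forall (Z : over T) (h : ohom X Z),
    hom_eq (ohom_comp h f) (ohom_comp h g) ->
    exists u : ohom Q Z,
      hom_eq (ohom_comp u q) h /\
      forall u' : ohom Q Z, hom_eq (ohom_comp u' q) h -> hom_eq u' u.

Record subgraph (G : graph) := Subgraph {
  inV : vert G -> Prop;
  inE : edge G -> Prop;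
  sub_src : forall e, inE e -> inV (src e);
  sub_tgt : forall e, inE e -> inV (tgt e) }.

Definition sub_le (G : graph) (H K : subgraph G) : Prop :=
  (forall v, inV H v -> inV K v) /\ (forall e, inE H e -> inE K e).

Definition sub_eq (G : graph) (H K : subgraph G) : Prop :=
  (forall v, inV H v <-> inV K v) /\ (forall e, inE H e <-> inE K e).

Definition sub_disjoint (G : graph) (H K : subgraph G) : Prop :=
  (forall v, ~ (inV H v /\ inV K v)) /\ (forall e, ~ (inE H e /\ inE K e)).

Definition full_sub (G : graph) (P : vert G -> Prop) : subgraph G :=
  @Subgraph G P (fun e => P (src e) /\ P (tgt e))
    (fun e he => proj1 he) (fun e he => proj2 he).

Definition whole (G : graph) : subgraph G :=
  @Subgraph G (fun _ => True) (fun _ => True) (fun _ _ => I) (fun _ _ => I).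

(* [G \ H].  Edges of [H] are removed too, since their endpoints lie in [H]. *)
Definition sub_compl (G : graph) (H : subgraph G) : subgraph G :=
  full_sub (fun v => ~ inV H v).

(* [H \ b], for a vertex [b] of [G], as a subgraph of [G]. *)
Definition del_vert (G : graph) (H : subgraph G) (b : vert G) : subgraph G :=
  @Subgraph G (fun v => inV H v /\ v <> b)
    (fun e => inE H e /\ src e <> b /\ tgt e <> b)
    (fun e he => conj (sub_src (proj1 he)) (proj1 (proj2 he)))
    (fun e he => conj (sub_tgt (proj1 he)) (proj2 (proj2 he))).

Definition sub_graph (G : graph) (H : subgraph G) : graph :=
  @Graph {v | inV H v} {e | inE H e}
    (fun e => exist _ (src (proj1_sig e)) (sub_src (proj2_sig e)))
    (fun e => exist _ (tgt (proj1_sig e)) (sub_tgt (proj2_sig e))).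

Definition sub_incl (G : graph) (H : subgraph G) : hom (sub_graph H) G :=
  @Hom (sub_graph H) G (fun v => proj1_sig v) (fun e => proj1_sig e)
    (fun _ => eq_refl) (fun _ => eq_refl).

Definition sub_over (T : graph) (G : over T) (H : subgraph G) : over T :=
  @Over T (sub_graph H) (hom_comp (typ G) (sub_incl H)).

Definition sub_oincl (T : graph) (G : over T) (H : subgraph G) :
  ohom (sub_over H) G := @OHom T (sub_over H) G (sub_incl H) (hom_eq_refl _).

Definition adj (G : graph) (v w : vert G) : Prop :=
  exists e : edge G, src e = v /\ tgt e = w.

Inductive G2V := eta | omega.
Inductive G2E := eta_omega | omega_eta | omega_omega.

Definition G2 : graph := @Graph G2V G2E
  (fun e => match e with eta_omega => eta | omega_eta => omega | omega_omega => omega end)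
  (fun e => match e with eta_omega => omega | omega_eta => eta | omega_omega => omega end).

Inductive G3V := g2v (v : G2V) | bang.
Inductive G3E := g2e (e : G2E) | bang_bang | bang_eta | bang_omega.

Definition G3 : graph := @Graph G3V G3E
  (fun e => match e with
            | g2e e => g2v (@src G2 e)
            | bang_bang | bang_eta | bang_omega => bang
            end)
  (fun e => match e with
            | g2e e => g2v (@tgt G2 e)
            | bang_bang => bang
            | bang_eta => g2v eta
            | bang_omega => g2v omega
            end).

Definition is_node (G : over G3) (v : vert G) : Prop := onV (typ G) v = g2v eta.
Definition is_wire (G : over G3) (v : vert G) : Prop := onV (typ G) v = g2v omega.
Definition is_bang (G : over G3) (v : vert G) : Prop := onV (typ G) v = bang.

Definition string_graph (G : over G2) : Prop :=
  forall v : vert G, onV (typ G) v = omega ->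
    (forall e e' : edge G, tgt e = v -> tgt e' = v -> e = e') /\
    (forall e e' : edge G, src e = v -> src e' = v -> e = e').

Definition Sigma_sub (G : over G3) : subgraph G :=
  full_sub (fun v : vert G => is_node v \/ is_wire v).

(* [Sigma_sub G] is typed over [G3]; its typing takes values in [G2] only, and
   the following functions read it as a typing over [G2]. *)
Definition g2v_of (x : G3V) : x <> bang -> G2V :=
  match x return x <> bang -> G2V with
  | g2v v => fun _ => v
  | bang => fun h => False_rect G2V (h eq_refl)
  end.

Definition g2e_of (e : G3E) : @src G3 e <> bang -> G2E :=
  match e return @src G3 e <> bang -> G2E with
  | g2e e => fun _ => e
  | bang_bang | bang_eta | bang_omega => fun h => False_rect G2E (h eq_refl)
  end.

Lemma g2e_of_src (e : G3E) (h : @src G3 e <> bang) (x : G3V) (hx : x <> bang) :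
  @src G3 e = x -> @src G2 (g2e_of h) = g2v_of hx.
Proof.
  intro E; subst x; destruct e; simpl in *; try reflexivity;
    exfalso; apply h; reflexivity.
Qed.

Lemma g2e_of_tgt (e : G3E) (h : @src G3 e <> bang) (x : G3V) (hx : x <> bang) :
  @tgt G3 e = x -> @tgt G2 (g2e_of h) = g2v_of hx.
Proof.
  intro E; subst x; destruct e; simpl in *; try reflexivity;
    exfalso; apply h; reflexivity.
Qed.

Section Sigma.
Variable G : over G3.

Lemma Sigma_not_bang (v : vert (sub_over (Sigma_sub G))) :
  onV (typ (sub_over (Sigma_sub G))) v <> bang.
Proof.
  destruct v as [v [h | h]]; simpl; rewrite h; discriminate.
Qed.

Lemma Sigma_src_not_bang (e : edge (sub_over (Sigma_sub G))) :
  src (onE (typ (sub_over (Sigma_sub G))) e) <> bang.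
Proof. rewrite hom_src; apply Sigma_not_bang. Qed.

Definition Sigma_typ : hom (sub_graph (Sigma_sub G)) G2 :=
  @Hom (sub_graph (Sigma_sub G)) G2
    (fun v => g2v_of (@Sigma_not_bang v))
    (fun e => g2e_of (@Sigma_src_not_bang e))
    (fun e => @g2e_of_src _ (@Sigma_src_not_bang e) _ (@Sigma_not_bang (src e))
                (hom_src (typ (sub_over (Sigma_sub G))) e))
    (fun e => @g2e_of_tgt _ (@Sigma_src_not_bang e) _ (@Sigma_not_bang (tgt e))
                (hom_tgt (typ (sub_over (Sigma_sub G))) e)).

Definition Sigma : over G2 := Over Sigma_typ.

End Sigma.

Definition is_input (G : over G3) (v : vert G) : Prop :=
  is_wire v /\ forall e : edge G, tgt e = v -> is_bang (src e).

Definition is_output (G : over G3) (v : vert G) : Prop :=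
  is_wire v /\ forall e : edge G, src e <> v.

Definition open_sub (G : over G3) (O : subgraph G) : Prop :=
  (forall v : vert (sub_over (sub_compl O)),
     is_input v -> is_input (onV (sub_oincl (sub_compl O)) v)) /\
  (forall v : vert (sub_over (sub_compl O)),
     is_output v -> is_output (onV (sub_oincl (sub_compl O)) v)).

Definition beta (G : over G3) : graph :=
  sub_graph (full_sub (fun v : vert G => is_bang v)).

Definition posetal (H : graph) : Prop :=
  (forall e e' : edge H, src e = src e' -> tgt e = tgt e' -> e = e') /\
  order (vert H) (@adj H).

Definition B (G : graph) (b : vert G) : subgraph G :=
  full_sub (fun v => exists e : edge G, src e = b /\ tgt e = v).

Definition Bup (G : graph) (b : vert G) : subgraph G :=
  full_sub (fun v => exists e : edge G, tgt e = b /\ src e = v).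

Record pattern_graph (G : over G3) : Prop := PatternGraph {
  pattern_string : string_graph (Sigma G);
  pattern_posetal : posetal (beta G);
  pattern_open : forall b : vert G, is_bang b -> open_sub (B b);
  pattern_nested : forall b b' : vert G, is_bang b -> is_bang b' ->
    inV (B b) b' -> sub_le (B b') (B b) }.

(* COPY and MERGE are only determined up to isomorphism, so they are given as
   the predicates "[C] is a pushout", "[M] is a coequaliser" of the relevant
   diagram.  Existence is [COPY_exists] and [MERGE_exists] below. *)

Definition is_COPY (G : over G3) (b : vert G) (C : over G3) : Prop :=
  exists i j : ohom G C,
    is_pushout (sub_oincl (sub_compl (B b))) (sub_oincl (sub_compl (B b))) i j.

Definition DROP (G : over G3) (b : vert G) : over G3 :=
  sub_over (del_vert (whole G) b).

Definition KILL (G : over G3) (b : vert G) : over G3 :=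
  sub_over (sub_compl (B b)).

(* For a pattern graph [G], at most one edge joins two !-vertices, so these
   conditions determine [phi]. *)
Definition Bup_iso (G : over G3) (b b' : vert G)
    (phi : ohom (sub_over (Bup b)) (sub_over (Bup b'))) : Prop :=
  is_iso phi /\
  (forall v, proj1_sig v = b -> proj1_sig (onV phi v) = b') /\
  (forall v, inV (del_vert (Bup b) b) (proj1_sig v) ->
     proj1_sig (onV phi v) = proj1_sig v) /\
  (forall e, inE (del_vert (Bup b) b) (proj1_sig e) ->
     proj1_sig (onE phi e) = proj1_sig e).

Definition is_MERGE (G : over G3) (b b' : vert G) (M : over G3) : Prop :=
  exists (phi : ohom (sub_over (Bup b)) (sub_over (Bup b'))) (q : ohom G M),
    Bup_iso phi /\
    is_coequaliser (sub_oincl (Bup b)) (ohom_comp (sub_oincl (Bup b')) phi) q.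

Section Quotient.
Variables (A : Type) (R : A -> A -> Prop).

Definition quot : Type :=
  {P : A -> Prop | exists a, P = clos_refl_sym_trans A R a}.

Definition cls (a : A) : quot :=
  exist _ (clos_refl_sym_trans A R a) (ex_intro _ a eq_refl).

Definition rep (q : quot) : A :=
  proj1_sig (constructive_indefinite_description _ (proj2_sig q)).

Lemma sig_eq (B : Type) (P : B -> Prop) (x y : sig P) :
  proj1_sig x = proj1_sig y -> x = y.
Proof.
  destruct x as [x hx], y as [y hy]; simpl; intro E; subst y.
  rewrite (proof_irrelevance _ hx hy); reflexivity.
Qed.

Lemma cls_rep (q : quot) : cls (rep q) = q.
Proof.
  apply sig_eq; simpl; unfold rep.
  destruct (constructive_indefinite_description _ _) as [a Ha]; simpl; auto.
Qed.

Lemma cls_eq (a a' : A) : R a a' -> cls a = cls a'.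
Proof.
  intro H; apply sig_eq; simpl; apply functional_extensionality; intro c.
  apply propositional_extensionality; split; intro K.
  - apply rst_trans with a; [apply rst_sym, rst_step |]; assumption.
  - apply rst_trans with a'; [apply rst_step |]; assumption.
Qed.

Lemma cls_inv (a a' : A) : cls a = cls a' -> clos_refl_sym_trans A R a a'.
Proof.
  intro E; apply (f_equal (@proj1_sig _ _)) in E; simpl in E.
  rewrite E; apply rst_refl.
Qed.

Lemma lift_rst (C : Type) (f : A -> C) (Hf : forall a a', R a a' -> f a = f a')
  (a a' : A) : clos_refl_sym_trans A R a a' -> f a = f a'.
Proof. induction 1; [apply Hf | | symmetry | transitivity (f y)]; auto. Qed.

Lemma rep_cls (C : Type) (f : A -> C) (Hf : forall a a', R a a' -> f a = f a')
  (a : A) : f (rep (cls a)) = f a.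
Proof. apply (lift_rst Hf), cls_inv, cls_rep. Qed.

End Quotient.

Section Coequaliser.
Variables (T : graph) (A X : over T) (f g : ohom A X).

Definition coeqRV (x y : vert X) : Prop := exists a, x = onV f a /\ y = onV g a.
Definition coeqRE (x y : edge X) : Prop := exists a, x = onE f a /\ y = onE g a.

Lemma coeq_src (x y : edge X) : coeqRE x y -> cls coeqRV (src x) = cls coeqRV (src y).
Proof.
  intros [a [-> ->]]; rewrite !hom_src; apply cls_eq; exists (src a); auto.
Qed.

Lemma coeq_tgt (x y : edge X) : coeqRE x y -> cls coeqRV (tgt x) = cls coeqRV (tgt y).
Proof.
  intros [a [-> ->]]; rewrite !hom_tgt; apply cls_eq; exists (tgt a); auto.
Qed.

Definition coeq_graph : graph :=
  @Graph (quot coeqRV) (quot coeqRE)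
    (fun e => cls coeqRV (src (rep e))) (fun e => cls coeqRV (tgt (rep e))).

Definition coeq_proj : hom X coeq_graph :=
  @Hom X coeq_graph (cls coeqRV) (cls coeqRE)
    (rep_cls coeq_src) (rep_cls coeq_tgt).

Lemma coeq_liftV (Z : graph) (h : hom X Z) :
  hom_eq (hom_comp h f) (hom_comp h g) ->
  forall x y, coeqRV x y -> onV h x = onV h y.
Proof. intros [HV _] x y [a [-> ->]]; apply HV. Qed.

Lemma coeq_liftE (Z : graph) (h : hom X Z) :
  hom_eq (hom_comp h f) (hom_comp h g) ->
  forall x y, coeqRE x y -> onE h x = onE h y.
Proof. intros [_ HE] x y [a [-> ->]]; apply HE. Qed.

Lemma coeq_lift_src (Z : graph) (h : hom X Z)
  (H : hom_eq (hom_comp h f) (hom_comp h g)) (e : edge coeq_graph) :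
  src (onE h (rep e)) = onV h (rep (src e)).
Proof.
  simpl; rewrite (rep_cls (coeq_liftV H)); apply hom_src.
Qed.

Lemma coeq_lift_tgt (Z : graph) (h : hom X Z)
  (H : hom_eq (hom_comp h f) (hom_comp h g)) (e : edge coeq_graph) :
  tgt (onE h (rep e)) = onV h (rep (tgt e)).
Proof.
  simpl; rewrite (rep_cls (coeq_liftV H)); apply hom_tgt.
Qed.

Definition coeq_lift (Z : graph) (h : hom X Z)
  (H : hom_eq (hom_comp h f) (hom_comp h g)) : hom coeq_graph Z :=
  @Hom coeq_graph Z (fun v => onV h (rep v)) (fun e => onE h (rep e))
    (coeq_lift_src H) (coeq_lift_tgt H).

Lemma coeq_lift_proj (Z : graph) (h : hom X Z)
  (H : hom_eq (hom_comp h f) (hom_comp h g)) :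
  hom_eq (hom_comp (coeq_lift H) coeq_proj) h.
Proof.
  split; intro x; simpl;
    [apply (rep_cls (coeq_liftV H)) | apply (rep_cls (coeq_liftE H))].
Qed.

Lemma coeq_typ_compat : hom_eq (hom_comp (typ X) f) (hom_comp (typ X) g).
Proof.
  destruct (ohom_typ f) as [fV fE], (ohom_typ g) as [gV gE]; simpl in *.
  split; intro x; simpl; congruence.
Qed.

Definition coeq : over T := Over (coeq_lift coeq_typ_compat).

Definition coeq_oproj : ohom X coeq :=
  @OHom T X coeq coeq_proj (coeq_lift_proj coeq_typ_compat).

Lemma coeq_is_coequaliser : is_coequaliser f g coeq_oproj.
Proof.
  split.
  - split; intro a; simpl; apply cls_eq; exists a; auto.
  - intros Z h H.
    assert (K : hom_eq (hom_comp (typ Z) (coeq_lift H)) (typ coeq)).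
    { destruct (ohom_typ h) as [hV hE]; split; intro x; simpl in *; auto. }
    exists (@OHom T coeq Z (coeq_lift H) K); split.
    + exact (coeq_lift_proj H).
    + intros u' [UV UE]; split; intro x; simpl in *.
      * rewrite <- (cls_rep x) at 1; apply UV.
      * rewrite <- (cls_rep x) at 1; apply UE.
Qed.

End Coequaliser.

Section Coproduct.
Variables (T : graph) (X Y : over T).

Definition sum_map (A B A' B' : Type) (f : A -> A') (g : B -> B') (x : A + B) : A' + B' :=
  match x with inl a => inl (f a) | inr b => inr (g b) end.

Definition copair (A B C : Type) (f : A -> C) (g : B -> C) (x : A + B) : C :=
  match x with inl a => f a | inr b => g b end.

Definition sum_graph : graph :=
  @Graph (vert X + vert Y) (edge X + edge Y)
    (sum_map (@src X) (@src Y)) (sum_map (@tgt X) (@tgt Y)).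

Lemma hcopair_src (Z : graph) (h : hom X Z) (k : hom Y Z) (e : edge sum_graph) :
  src (copair (onE h) (onE k) e) = copair (onV h) (onV k) (src e).
Proof. destruct e; simpl; apply hom_src. Qed.

Lemma hcopair_tgt (Z : graph) (h : hom X Z) (k : hom Y Z) (e : edge sum_graph) :
  tgt (copair (onE h) (onE k) e) = copair (onV h) (onV k) (tgt e).
Proof. destruct e; simpl; apply hom_tgt. Qed.

Definition hcopair (Z : graph) (h : hom X Z) (k : hom Y Z) : hom sum_graph Z :=
  Hom (hcopair_src h k) (hcopair_tgt h k).

Definition osum : over T := Over (hcopair (typ X) (typ Y)).

Definition oinl : ohom X osum :=
  @OHom T X osum
    (@Hom X sum_graph inl inl (fun _ => eq_refl) (fun _ => eq_refl)) (hom_eq_refl _).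

Definition oinr : ohom Y osum :=
  @OHom T Y osum
    (@Hom Y sum_graph inr inr (fun _ => eq_refl) (fun _ => eq_refl)) (hom_eq_refl _).

Lemma ocopair_typ (Z : over T) (h : ohom X Z) (k : ohom Y Z) :
  hom_eq (hom_comp (typ Z) (hcopair h k)) (typ osum).
Proof.
  destruct (ohom_typ h), (ohom_typ k); split; intros [x | x]; simpl in *; auto.
Qed.

Definition ocopair (Z : over T) (h : ohom X Z) (k : ohom Y Z) : ohom osum Z :=
  @OHom T osum Z (hcopair h k) (ocopair_typ h k).

End Coproduct.

Lemma pushout_exists (T : graph) (A X Y : over T) (f : ohom A X) (g : ohom A Y) :
  exists (P : over T) (i : ohom X P) (j : ohom Y P), is_pushout f g i j.
Proof.
  set (f' := ohom_comp (oinl X Y) f); set (g' := ohom_comp (oinr X Y) g).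
  exists (coeq f' g'), (ohom_comp (coeq_oproj f' g') (oinl X Y)),
    (ohom_comp (coeq_oproj f' g') (oinr X Y)).
  destruct (coeq_is_coequaliser f' g') as [[CV CE] U]; split.
  - split; assumption.
  - intros Z h k [HV HE].
    destruct (U Z (ocopair h k)) as [u [[uV uE] uU]].
    { split; assumption. }
    exists u; split; [split; split; intro x |].
    + apply (uV (inl x)).
    + apply (uE (inl x)).
    + apply (uV (inr x)).
    + apply (uE (inr x)).
    + intros u' [hV hE] [kV kE]; apply uU; split; intros [x | x]; simpl in *; auto.
Qed.

Lemma COPY_exists (G : over G3) (b : vert G) : exists C, is_COPY b C.
Proof.
  destruct (pushout_exists (sub_oincl (sub_compl (B b))) (sub_oincl (sub_compl (B b))))
    as [P [i [j H]]].
  exists P, i, j; exact H.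
Qed.

Section Merge.
Variable G : over G3.
Hypothesis HG : pattern_graph G.

Lemma src_bang (e : edge G) : is_bang (tgt e) -> is_bang (src e).
Proof.
  unfold is_bang; rewrite <- hom_src, <- hom_tgt.
  destruct (onE (typ G) e) as [[]| | |]; simpl; try reflexivity; discriminate.
Qed.

Lemma bang_edge_typ (e : edge G) : is_bang (tgt e) -> onE (typ G) e = bang_bang.
Proof.
  unfold is_bang; rewrite <- hom_tgt.
  destruct (onE (typ G) e) as [[]| | |]; simpl; try reflexivity; discriminate.
Qed.

Lemma bang_edge_eq (e e' : edge G) :
  is_bang (tgt e) -> src e = src e' -> tgt e = tgt e' -> e = e'.
Proof.
  intros Ht Es Et.
  assert (Ht' : is_bang (tgt e')) by (rewrite <- Et; exact Ht).
  set (x := exist _ e (conj (src_bang Ht) Ht) : edge (beta G)).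
  set (y := exist _ e' (conj (src_bang Ht') Ht') : edge (beta G)).
  change (proj1_sig x = proj1_sig y); f_equal.
  apply (proj1 (pattern_posetal HG)); apply sig_eq; assumption.
Qed.

Lemma bang_refl (b : vert G) : is_bang b -> adj b b.
Proof.
  intro Hb; destruct (pattern_posetal HG) as [_ [R _ _]].
  destruct (R (exist _ b Hb)) as [[e he] [Es Et]].
  apply (f_equal (@proj1_sig _ _)) in Es; apply (f_equal (@proj1_sig _ _)) in Et.
  exists e; auto.
Qed.

Lemma bang_antisym (b c : vert G) : is_bang b -> is_bang c ->
  adj b c -> adj c b -> b = c.
Proof.
  intros Hb Hc [e [Es Et]] [e' [Es' Et']]; destruct (pattern_posetal HG) as [_ [_ _ S]].
  assert (he : is_bang (src e) /\ is_bang (tgt e)) by (rewrite Es, Et; auto).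
  assert (he' : is_bang (src e') /\ is_bang (tgt e')) by (rewrite Es', Et'; auto).
  refine (f_equal (@proj1_sig _ _) (S (exist _ b Hb) (exist _ c Hc) _ _)).
  - exists (exist _ e he); split; apply sig_eq; assumption.
  - exists (exist _ e' he'); split; apply sig_eq; assumption.
Qed.

Definition mergeV (b b' v : vert G) : vert G :=
  if excluded_middle_informative (v = b) then b' else v.

Lemma mergeV_b (b b' : vert G) : mergeV b b' b = b'.
Proof. unfold mergeV; destruct excluded_middle_informative; congruence. Qed.

Lemma mergeV_ne (b b' v : vert G) : v <> b -> mergeV b b' v = v.
Proof. unfold mergeV; destruct excluded_middle_informative; congruence. Qed.

Lemma Bup_bang (b v : vert G) : is_bang b -> inV (Bup b) v -> is_bang v.
Proof. intros Hb [e [<- <-]]; apply src_bang; assumption. Qed.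

Section Phi.
Variables b b' : vert G.
Hypotheses (Hb : is_bang b) (Hb' : is_bang b').
Hypothesis Heq : sub_eq (del_vert (Bup b) b) (del_vert (Bup b') b').

Lemma mergeV_in (v : vert G) : inV (Bup b) v -> inV (Bup b') (mergeV b b' v).
Proof.
  intro Hv; destruct (classic (v = b)) as [-> | N].
  - rewrite mergeV_b; destruct (bang_refl Hb') as [e [Es Et]]; exists e; auto.
  - rewrite mergeV_ne by assumption.
    exact (proj1 (proj1 (proj1 Heq v) (conj Hv N))).
Qed.

Lemma phiE_ex (e : {e | inE (Bup b) e}) : exists e' : {e | inE (Bup b') e},
  src (proj1_sig e') = mergeV b b' (src (proj1_sig e)) /\
  tgt (proj1_sig e') = mergeV b b' (tgt (proj1_sig e)).
Proof.
  destruct e as [e he]; simpl.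
  assert (K : exists e', src e' = mergeV b b' (src e) /\ tgt e' = mergeV b b' (tgt e)).
  { destruct (classic (tgt e = b)) as [Et | Nt].
    - rewrite Et, mergeV_b.
      destruct (mergeV_in (proj1 he)) as [e' [Et' Es']]; exists e'; auto.
    - destruct (classic (src e = b)) as [Es | Ns].
      + exfalso; apply Nt; symmetry; apply bang_antisym; auto.
        * exact (Bup_bang Hb (proj2 he)).
        * exists e; auto.
        * destruct (proj2 he) as [e' [Et' Es']]; exists e'; auto.
      + rewrite !mergeV_ne by assumption; exists e; auto. }
  destruct K as [e' [Es Et]].
  assert (he' : inE (Bup b') e').
  { split; [rewrite Es | rewrite Et]; apply mergeV_in; apply he. }
  exists (exist _ e' he'); auto.
Qed.

Definition phiE (e : {e | inE (Bup b) e}) : {e | inE (Bup b') e} :=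
  proj1_sig (constructive_indefinite_description _ (phiE_ex e)).

Lemma phiE_spec (e : {e | inE (Bup b) e}) :
  src (proj1_sig (phiE e)) = mergeV b b' (src (proj1_sig e)) /\
  tgt (proj1_sig (phiE e)) = mergeV b b' (tgt (proj1_sig e)).
Proof. exact (proj2_sig (constructive_indefinite_description _ (phiE_ex e))). Qed.

Definition phiV (v : {v | inV (Bup b) v}) : {v | inV (Bup b') v} :=
  exist _ (mergeV b b' (proj1_sig v)) (mergeV_in (proj2_sig v)).

Definition phi_hom : hom (sub_graph (Bup b)) (sub_graph (Bup b')) :=
  @Hom (sub_graph (Bup b)) (sub_graph (Bup b')) phiV phiE
    (fun e => @sig_eq _ _ (exist _ _ _) (exist _ _ _) (proj1 (phiE_spec e)))
    (fun e => @sig_eq _ _ (exist _ _ _) (exist _ _ _) (proj2 (phiE_spec e))).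

Lemma phi_typ :
  hom_eq (hom_comp (typ (sub_over (Bup b'))) phi_hom) (typ (sub_over (Bup b))).
Proof.
  split; intro x.
  - transitivity bang; [| symmetry].
    + exact (Bup_bang Hb' (proj2_sig (phiV x))).
    + exact (Bup_bang Hb (proj2_sig x)).
  - transitivity bang_bang; [| symmetry]; apply bang_edge_typ.
    + exact (Bup_bang Hb' (proj2 (proj2_sig (phiE x)))).
    + exact (Bup_bang Hb (proj2 (proj2_sig x))).
Qed.

Definition phi : ohom (sub_over (Bup b)) (sub_over (Bup b')) :=
  @OHom G3 (sub_over (Bup b)) (sub_over (Bup b')) phi_hom phi_typ.

End Phi.

Lemma mergeV_inv (b b' v : vert G) : is_bang b -> is_bang b' ->
  sub_eq (del_vert (Bup b) b) (del_vert (Bup b') b') ->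
  inV (Bup b) v -> mergeV b' b (mergeV b b' v) = v.
Proof.
  intros Hb Hb' Heq Hv; destruct (classic (v = b)) as [-> | N].
  - rewrite !mergeV_b; reflexivity.
  - rewrite (mergeV_ne (b:=b)) by assumption; apply mergeV_ne.
    exact (proj2 (proj1 (proj1 Heq v) (conj Hv N))).
Qed.

Lemma phi_inv (b b' : vert G) (Hb : is_bang b) (Hb' : is_bang b')
  (Heq : sub_eq (del_vert (Bup b) b) (del_vert (Bup b') b'))
  (Heq' : sub_eq (del_vert (Bup b') b') (del_vert (Bup b) b)) :
  hom_eq (ohom_comp (phi Hb' Hb Heq') (phi Hb Hb' Heq)) (ohom_id (sub_over (Bup b))).
Proof.
  split; intros [x hx]; apply sig_eq; simpl.
  - apply mergeV_inv; assumption.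
  - set (y := exist _ x hx : {e | inE (Bup b) e}).
    destruct (phiE_spec Hb Hb' Heq y) as [Es Et].
    destruct (phiE_spec Hb' Hb Heq' (phiE Hb Hb' Heq y)) as [Es' Et'].
    apply bang_edge_eq.
    + exact (Bup_bang Hb (proj2 (proj2_sig (phiE Hb' Hb Heq' (phiE Hb Hb' Heq y))))).
    + refine (eq_trans Es' _); rewrite Es; apply mergeV_inv; auto; apply hx.
    + refine (eq_trans Et' _); rewrite Et; apply mergeV_inv; auto; apply hx.
Qed.

Lemma MERGE_exists (b b' : vert G) : is_bang b -> is_bang b' ->
  sub_eq (del_vert (Bup b) b) (del_vert (Bup b') b') ->
  exists M, is_MERGE b b' M.
Proof.
  intros Hb Hb' Heq.
  assert (Heq' : sub_eq (del_vert (Bup b') b') (del_vert (Bup b) b)).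
  { destruct Heq as [HV HE]; split; intro x; split; intro h;
      first [apply HV | apply HE]; exact h. }
  set (p := phi Hb Hb' Heq).
  exists (coeq (sub_oincl (Bup b)) (ohom_comp (sub_oincl (Bup b')) p)), p,
    (coeq_oproj (sub_oincl (Bup b)) (ohom_comp (sub_oincl (Bup b')) p)).
  split; [| apply coeq_is_coequaliser].
  split; [| split; [| split]].
  - exists (phi Hb' Hb Heq'); split; apply phi_inv.
  - intros [v hv] E; simpl in *; subst v; apply mergeV_b.
  - intros [v hv] [_ N]; simpl in *; apply mergeV_ne; exact N.
  - intros [e he] [_ [Ns Nt]]; simpl in *.
    destruct (phiE_spec Hb Hb' Heq (exist _ e he)) as [Es Et]; simpl in *.
    rewrite mergeV_ne in Es, Et by assumption.
    apply bang_edge_eq; auto.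
    rewrite Et; exact (Bup_bang Hb (proj2 he)).
Qed.

End Merge.

(* Main.v *)
Require Import Defs.
From Stdlib Require Import Classical ClassicalEpsilon PropExtensionality.

Set Implicit Arguments.
Unset Strict Implicit.

(** Being a pattern graph is equivalent to a list of first-order conditions on
    the edges (the record [pattern_axioms]); in particular, given the string
    graph condition, openness of [B b] says exactly that [B b] absorbs the
    wire-vertices at either end of its edges.  These conditions are inherited
    by full subgraphs, which settles DROP and KILL.  A pushout or coequaliser
    is covered by the images of its legs, and mapping it to graphs with as many
    edges as possible shows which vertices are identified.  For COPY, two
    edges of different copies meet at a vertex only outside [B b], and an edge
    from a !-vertex to a vertex outside [B b] lies in both copies, so each
    configuration of edges to be checked can be moved into a single copy.  For
    MERGE, [B b] and [B b'] being disjoint prevents new parallel edges out of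
    the merged vertex and cycles through it, and [b], [b'] having the same
    predecessors lets an edge into one be replaced by an edge into the other. *)

(** Edges from !-vertices to wire-vertices lie outside [Sigma G], so [wire_in_unique] has to exclude
    them; every out-edge of a wire-vertex lies inside. As [v] in [bang_adj_trans] has any type, that
    field covers both transitivity on [beta G] and the nesting of the subgraphs [B b]. *)
Record pattern_axioms (G : over G3) : Prop := PatternAxioms {
  wire_in_unique : forall e e' : edge G, is_wire (tgt e) ->
    ~ is_bang (src e) -> ~ is_bang (src e') -> tgt e = tgt e' -> e = e';
  wire_out_unique : forall e e' : edge G, is_wire (src e) -> src e = src e' -> e = e';
  bang_edge_unique : forall e e' : edge G, is_bang (tgt e) ->
    src e = src e' -> tgt e = tgt e' -> e = e';
  bang_adj_refl : forall b : vert G, is_bang b -> adj b b;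
  bang_adj_antisym : forall b c : vert G, is_bang b -> is_bang c ->
    adj b c -> adj c b -> b = c;
  bang_adj_trans : forall b c v : vert G, is_bang b -> is_bang c ->
    adj b c -> adj c v -> adj b v;
  open_in : forall (b : vert G) (e : edge G), is_bang b -> is_wire (tgt e) ->
    ~ is_bang (src e) -> adj b (src e) -> adj b (tgt e);
  open_out : forall (b : vert G) (e : edge G), is_bang b -> is_wire (src e) ->
    adj b (tgt e) -> adj b (src e) }.

(** * Pattern graphs in first-order terms *)

Section Typing.
Variable G : over G3.
Implicit Types (v : vert G) (e : edge G).

Lemma wire_not_bang v : is_wire v -> ~ is_bang v.
Proof. unfold is_wire, is_bang; congruence. Qed.

Lemma not_bang v : ~ is_bang v -> is_node v \/ is_wire v.
Proof.
  unfold is_bang, is_node, is_wire.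
  destruct (onV (typ G) v) as [[] |]; tauto.
Qed.

Lemma not_bang_tgt e : ~ is_bang (src e) -> ~ is_bang (tgt e).
Proof. intros N H; apply N, src_bang, H. Qed.

End Typing.

Lemma g2v_of_eq (x : G3V) (hx : x <> bang) (v : G2V) : g2v_of hx = v <-> x = g2v v.
Proof.
  destruct x as [w |]; simpl; [split; congruence | exfalso; auto].
Qed.

Section Characterisation.
Variable G : over G3.

(** No edge of [G3] leads from [eta] or [omega] to [bang], so an edge lies in [Sigma G] as soon as
    its source is not a !-vertex. *)
Lemma string_graph_Sigma : string_graph (Sigma G) <->
  (forall e e' : edge G, is_wire (tgt e) ->
    ~ is_bang (src e) -> ~ is_bang (src e') -> tgt e = tgt e' -> e = e') /\
  (forall e e' : edge G, is_wire (src e) -> src e = src e' -> e = e').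
Proof.
  split.
  - intro H.
    assert (lift : forall e : edge G, ~ is_bang (src e) -> inE (Sigma_sub G) e).
    { intros e N; split; apply not_bang; [| apply not_bang_tgt]; exact N. }
    split.
    + intros e e' W N N' E.
      assert (W' : onV (typ (Sigma G)) (exist _ (tgt e) (or_intror W)) = omega)
        by (apply g2v_of_eq, W).
      refine (f_equal (@proj1_sig _ _)
        (proj1 (H _ W') (exist _ e (lift e N)) (exist _ e' (lift e' N')) _ _));
        apply sig_eq; simpl; congruence.
    + intros e e' W E.
      assert (W' : onV (typ (Sigma G)) (exist _ (src e) (or_intror W)) = omega)
        by (apply g2v_of_eq, W).
      assert (N : ~ is_bang (src e)) by (apply wire_not_bang, W).
      assert (N' : ~ is_bang (src e')) by (rewrite <- E; exact N).
      refine (f_equal (@proj1_sig _ _)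
        (proj2 (H _ W') (exist _ e (lift e N)) (exist _ e' (lift e' N')) _ _));
        apply sig_eq; simpl; congruence.
  - intros [Hin Hout] [v hv] W; apply g2v_of_eq in W; simpl in W.
    assert (nb : forall w : vert G, is_node w \/ is_wire w -> ~ is_bang w)
      by (unfold is_node, is_wire, is_bang; intros w [h | h]; congruence).
    split; intros [e he] [e' he'] E E'; apply sig_eq; simpl;
      apply (f_equal (@proj1_sig _ _)) in E; apply (f_equal (@proj1_sig _ _)) in E';
      simpl in E, E'; subst v.
    + apply Hin; auto; apply nb; [apply he | apply he'].
    + apply Hout; auto.
Qed.

Lemma pattern_graphP : pattern_graph G <-> pattern_axioms G.
Proof.
  split.
  - intro H.
    destruct (proj1 string_graph_Sigma (pattern_string H)) as [Hin Hout].
    split; auto.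
    + intros e e'; apply (bang_edge_eq H).
    + apply (bang_refl H).
    + apply (bang_antisym H).
    + intros b c v Hb Hc bc cv; exact (proj1 (pattern_nested H Hb Hc bc) v cv).
    + intros b e Hb W N A; apply NNPP; intro NA.
      (* otherwise [e] is the only wire in-edge of its target, which would thus
         become an input of [G \ B b] *)
      assert (K : is_input (exist _ (tgt e) NA : vert (sub_over (sub_compl (B b))))).
      { split; [exact W |]; intros [e' he'] E; apply NNPP; intro N'.
        apply (f_equal (@proj1_sig _ _)) in E; simpl in E.
        apply (proj1 he'); replace e' with e by (apply Hin; auto); exact A. }
      apply N, (proj2 (proj1 (pattern_open H Hb) _ K)); reflexivity.
    + intros b e Hb W A; apply NNPP; intro NA.
      assert (K : is_output (exist _ (src e) NA : vert (sub_over (sub_compl (B b))))).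
      { split; [exact W |]; intros [e' he'] E.
        apply (f_equal (@proj1_sig _ _)) in E; simpl in E.
        apply (proj2 he'); replace e' with e by (apply Hout; auto); exact A. }
      exact (proj2 (proj2 (pattern_open H Hb) _ K) e eq_refl).
  - intros [Hin Hout Hu Hr Ha Ht Oi Oo]; split.
    + apply string_graph_Sigma; auto.
    + split; [| split].
      * intros [e he] [e' he'] Es Et.
        apply (f_equal (@proj1_sig _ _)) in Es; apply (f_equal (@proj1_sig _ _)) in Et.
        apply sig_eq; apply Hu; auto; apply he.
      * intros [v hv]; destruct (Hr v hv) as [e [Es Et]].
        assert (he : is_bang (src e) /\ is_bang (tgt e)) by (rewrite Es, Et; auto).
        exists (exist _ e he); split; apply sig_eq; assumption.
      * intros [x hx] [y hy] [z hz] [[e he] [Es Et]] [[f hf] [Fs Ft]].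
        apply (f_equal (@proj1_sig _ _)) in Es, Et, Fs, Ft; simpl in *.
        destruct (Ht x y z) as [g [Gs Gt]]; auto; [exists e; auto | exists f; auto |].
        assert (hg : is_bang (src g) /\ is_bang (tgt g)) by (rewrite Gs, Gt; auto).
        exists (exist _ g hg); split; apply sig_eq; assumption.
      * intros [x hx] [y hy] [[e he] [Es Et]] [[f hf] [Fs Ft]].
        apply (f_equal (@proj1_sig _ _)) in Es, Et, Fs, Ft; simpl in *.
        apply sig_eq, Ha; auto; [exists e; auto | exists f; auto].
    + intros b Hb; split; intros [v hv] [W H]; split; auto; intros e E; simpl in *.
      (* By [open_in], an edge from a non-! source to a wire-vertex outside [B b] also starts
         outside, so it survives in the complement and contradicts [H]. *)
      * apply NNPP; intro N; subst v.
        assert (he : inE (sub_compl (B b)) e).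
        { split; [| exact hv]; intro A; apply hv, (Oi b e Hb); auto. }
        apply N; refine (H (exist _ e he) _); apply sig_eq; reflexivity.
      * subst v.
        assert (he : inE (sub_compl (B b)) e).
        { split; [exact hv |]; intro A; apply hv, (Oo b e Hb); auto. }
        refine (H (exist _ e he) _); apply sig_eq; reflexivity.
    + intros b b' Hb Hb' A.
      assert (K : forall v, inV (B b') v -> inV (B b) v) by (intros v; apply Ht; auto).
      split; [exact K | intros e [h h']; split; apply K; assumption].
Qed.

End Characterisation.

(** * Full subgraphs *)

Lemma pattern_graph_full (G : over G3) (H : subgraph G) :
  (forall e, inV H (src e) -> inV H (tgt e) -> inE H e) ->
  pattern_graph G -> pattern_graph (sub_over H).
Proof.
  rewrite !pattern_graphP; intros full [Hin Hout Hu Hr Ha Ht Oi Oo].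
  (* Every edge whose existence the axioms demand joins two given vertices, so for vertices of [H]
     fullness places it in [H]. *)
  assert (adjP : forall x y : vert (sub_over H),
    adj x y <-> adj (proj1_sig x) (proj1_sig y)).
  { intros [x hx] [y hy]; simpl; split.
    - intros [[e he] [Es Et]]; exists e.
      apply (f_equal (@proj1_sig _ _)) in Es, Et; auto.
    - intros [e [Es Et]].
      assert (he : inE H e) by (apply full; congruence).
      exists (exist _ e he); split; apply sig_eq; assumption. }
  split.
  - intros [e he] [e' he'] W N N' E; apply (f_equal (@proj1_sig _ _)) in E.
    apply sig_eq, Hin; auto.
  - intros [e he] [e' he'] W E; apply (f_equal (@proj1_sig _ _)) in E.
    apply sig_eq, Hout; auto.
  - intros [e he] [e' he'] W Es Et; apply (f_equal (@proj1_sig _ _)) in Es, Et.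
    apply sig_eq, Hu; auto.
  - intros b Hb; apply adjP, Hr, Hb.
  - intros b c Hb Hc; rewrite !adjP; intros; apply sig_eq, Ha; auto.
  - intros b c v Hb Hc; rewrite !adjP; apply Ht; auto.
  - intros b [e he] Hb W N; rewrite !adjP; apply Oi; auto.
  - intros b [e he] Hb W; rewrite !adjP; apply Oo; auto.
Qed.

(** * Cofree typed graphs *)

Section Cofree.
Variables (T : graph) (W : Type) (tau : W -> vert T).

(* The terminal graph over [T] with vertex set [W]: a morphism into it is just
   a typed map of vertices. *)
Definition cofree_graph : graph :=
  @Graph W {x : edge T * (W * W) |
             src (fst x) = tau (fst (snd x)) /\ tgt (fst x) = tau (snd (snd x))}
    (fun x => fst (snd (proj1_sig x))) (fun x => snd (snd (proj1_sig x))).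

Definition cofree : over T :=
  @Over T cofree_graph
    (@Hom cofree_graph T tau (fun x => fst (proj1_sig x))
       (fun x => proj1 (proj2_sig x)) (fun x => proj2 (proj2_sig x))).

Lemma cofree_lift (X : over T) (f : vert X -> W) :
  (forall v, tau (f v) = onV (typ X) v) ->
  exists h : ohom X cofree, forall v, onV h v = f v.
Proof.
  intro Hf.
  assert (K : forall e : edge X, src (onE (typ X) e) = tau (f (src e)) /\
                                 tgt (onE (typ X) e) = tau (f (tgt e)))
    by (intro e; rewrite !Hf, hom_src, hom_tgt; auto).
  set (h := @Hom X cofree_graph f
    (fun e => exist _ (onE (typ X) e, (f (src e), f (tgt e))) (K e))
    (fun _ => eq_refl) (fun _ => eq_refl)).
  assert (Hh : hom_eq (hom_comp (typ cofree) h) (typ X)) by (split; [exact Hf | reflexivity]).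
  exists (@OHom T X cofree h Hh); reflexivity.
Qed.

Lemma cofree_hom_eq (X : over T) (h k : ohom X cofree) :
  (forall v, onV h v = onV k v) -> hom_eq h k.
Proof.
  intro H; split; [exact H | intro e].
  assert (K : forall x y : edge cofree, src x = src y -> tgt x = tgt y ->
    onE (typ cofree) x = onE (typ cofree) y -> x = y).
  { intros [[x [y z]] p] [[x' [y' z']] p'] Es Et Ee; apply sig_eq; simpl in *; congruence. }
  apply K.
  - rewrite !hom_src; apply H.
  - rewrite !hom_tgt; apply H.
  - exact (eq_trans (proj2 (ohom_typ h) e) (eq_sym (proj2 (ohom_typ k) e))).
Qed.

End Cofree.

(** * Consequences of the universal properties *)

Section Universal.
Variable T : graph.

Lemma ohom_typV (X Y : over T) (f : ohom X Y) (v : vert X) :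
  onV (typ Y) (onV f v) = onV (typ X) v.
Proof. exact (proj1 (ohom_typ f) v). Qed.

Lemma ohom_corestrict (X Y : over T) (f : ohom X Y) (H : subgraph Y) :
  (forall v, inV H (onV f v)) -> (forall e, inE H (onE f e)) ->
  exists g : ohom X (sub_over H), hom_eq (ohom_comp (sub_oincl H) g) f.
Proof.
  intros HV HE.
  set (g := @Hom X (sub_graph H) (fun v => exist _ _ (HV v)) (fun e => exist _ _ (HE e))
    (fun e => @sig_eq _ _ (exist _ _ _) (exist _ _ _) (hom_src f e))
    (fun e => @sig_eq _ _ (exist _ _ _) (exist _ _ _) (hom_tgt f e))).
  assert (Hg : hom_eq (hom_comp (typ (sub_over H)) g) (typ X)).
  { destruct (ohom_typ f) as [fV fE]; split; intro x; [apply fV | apply fE]. }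
  exists (@OHom T X (sub_over H) g Hg); split; reflexivity.
Qed.

Definition image (X Y : graph) (f : hom X Y) : subgraph Y :=
  @Subgraph Y (fun v => exists x, v = onV f x) (fun e => exists x, e = onE f x)
    (fun e he => let (x, hx) := he in
       ex_intro _ (src x) (eq_trans (f_equal src hx) (hom_src f x)))
    (fun e he => let (x, hx) := he in
       ex_intro _ (tgt x) (eq_trans (f_equal tgt hx) (hom_tgt f x))).

(** [q] factors through its image, which yields a map [u] from [Q] to that image. The inclusion
    after [u] and the identity both carry [q] to [q], hence agree, so the image is all of [Q]. *)
Lemma coequaliser_surj (A X Q : over T) (f g : ohom A X) (q : ohom X Q) :
  is_coequaliser f g q ->
  (forall v, exists x, v = onV q x) /\ (forall e, exists x, e = onE q x).
Proof.
  intros [[EV EE] U].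
  destruct (@ohom_corestrict X Q q (image q)) as [p [pV pE]];
    [intro x; exists x; reflexivity .. |].
  destruct (U _ p) as [u [[uV uE] _]].
  { split; intro x; apply sig_eq; [refine (eq_trans (pV _) (eq_trans (EV x) (eq_sym (pV _))))
      | refine (eq_trans (pE _) (eq_trans (EE x) (eq_sym (pE _))))]. }
  destruct (U _ q (conj EV EE)) as [w [_ wu]].
  destruct (wu (ohom_id Q)) as [idV idE]; [split; reflexivity |].
  destruct (wu (ohom_comp (sub_oincl (image q)) u)) as [iuV iuE].
  { split; intro x; [rewrite <- pV | rewrite <- pE]; simpl in *; congruence. }
  split; intro x.
  - destruct (proj2_sig (onV u x)) as [y Hy]; exists y.
    rewrite <- Hy; exact (eq_trans (idV x) (eq_sym (iuV x))).
  - destruct (proj2_sig (onE u x)) as [y Hy]; exists y.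
    rewrite <- Hy; exact (eq_trans (idE x) (eq_sym (iuE x))).
Qed.

(** Makes the facts about coequalisers available for pushouts. *)
Lemma pushout_coequaliser (A X Y P : over T) (f : ohom A X) (g : ohom A Y)
    (i : ohom X P) (j : ohom Y P) :
  is_pushout f g i j ->
  is_coequaliser (ohom_comp (oinl X Y) f) (ohom_comp (oinr X Y) g) (ocopair i j).
Proof.
  intros [[EV EE] U]; split; [split; assumption |].
  intros Z h [hV hE].
  destruct (U Z (ohom_comp h (oinl X Y)) (ohom_comp h (oinr X Y))) as [u [[[iV iE] [jV jE]] uu]].
  { split; assumption. }
  exists u; split.
  - split; intros [x | x]; simpl in *; auto.
  - intros u' [V E]; apply uu; split; intro x;
      first [exact (V (inl x)) | exact (E (inl x)) | exact (V (inr x)) | exact (E (inr x))].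
Qed.

(** Morphisms into [cofree] are just typed vertex maps, so [h] becomes a morphism that coequalises
    [f] and [g] and hence factors through [q]. *)
Lemma coequaliser_separates (A X Q : over T) (f g : ohom A X) (q : ohom X Q)
    (W : Type) (tau : W -> vert T) (h : vert X -> W) :
  is_coequaliser f g q ->
  (forall v, tau (h v) = onV (typ X) v) ->
  (forall a, h (onV f a) = h (onV g a)) ->
  forall x y, onV q x = onV q y -> h x = h y.
Proof.
  intros [_ U] Ht Hfg x y E.
  destruct (cofree_lift Ht) as [k Hk].
  destruct (U _ k) as [u [[uV _] _]].
  { apply (@cofree_hom_eq T W tau A (ohom_comp k f) (ohom_comp k g)).
    intro a; simpl; rewrite !Hk; apply Hfg. }
  rewrite <- !Hk; rewrite <- (uV x), <- (uV y); simpl; congruence.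
Qed.

End Universal.

Lemma adj_map (X Y : graph) (f : hom X Y) (v w : vert X) :
  adj v w -> adj (onV f v) (onV f w).
Proof. intros [e [<- <-]]; exists (onE f e); rewrite hom_src, hom_tgt; auto. Qed.

Lemma ohom_bang (X Y : over G3) (f : ohom X Y) (v : vert X) :
  is_bang (onV f v) <-> is_bang v.
Proof. unfold is_bang; rewrite ohom_typV; tauto. Qed.

Lemma ohom_wire (X Y : over G3) (f : ohom X Y) (v : vert X) :
  is_wire (onV f v) <-> is_wire v.
Proof. unfold is_wire; rewrite ohom_typV; tauto. Qed.

(** * Graphs covered by images of a pattern graph *)

Section Cover.
Variables (G C : over G3) (I : Type) (f : I -> ohom G C).
Hypothesis HG : pattern_axioms G.
Hypothesis surjV : forall v, exists s x, v = onV (f s) x.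
Hypothesis surjE : forall e, exists s x, e = onE (f s) x.
(** A lifting property: if the target of an edge from a !-vertex is identified with [w], some edge
    into [w] has the same source up to identification. The index [I] has two elements for COPY and
    one for MERGE. *)
Hypothesis lift : forall s t e w, is_bang (src e) ->
  onV (f s) (tgt e) = onV (f t) w ->
  exists v, onV (f s) (src e) = onV (f t) v /\ adj v w.

Lemma cover_adj x t w : is_bang x -> adj x (onV (f t) w) ->
  exists v, x = onV (f t) v /\ is_bang v /\ adj v w.
Proof.
  intros Hx [e [Es Et]]; subst x; destruct (surjE e) as [s [x ->]].
  rewrite hom_src, hom_tgt in *; rewrite ohom_bang in Hx.
  destruct (lift Hx Et) as [v [Ev A]]; exists v; split; [exact Ev | split; [| exact A]].
  rewrite <- (ohom_bang (f t)), <- Ev, ohom_bang; exact Hx.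
Qed.

(** The premises concern the axioms that identifications could break: uniqueness of edges and
    antisymmetry. The other axioms produce an edge, which is found in [G] after lifting the given
    ones to a single leg, and then mapped back. *)
Lemma cover_pattern :
  (forall s t e e', is_wire (tgt e) -> ~ is_bang (src e) -> ~ is_bang (src e') ->
     onV (f s) (tgt e) = onV (f t) (tgt e') -> onE (f s) e = onE (f t) e') ->
  (forall s t e e', is_wire (src e) ->
     onV (f s) (src e) = onV (f t) (src e') -> onE (f s) e = onE (f t) e') ->
  (forall s t e e', is_bang (tgt e) -> onV (f s) (src e) = onV (f t) (src e') ->
     onV (f s) (tgt e) = onV (f t) (tgt e') -> onE (f s) e = onE (f t) e') ->
  (forall t v w w', is_bang v -> is_bang w -> adj v w -> adj w' v ->
     onV (f t) w = onV (f t) w' -> onV (f t) v = onV (f t) w) ->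
  pattern_axioms C.
Proof.
  intros Hin Hout Hu Ha; split.
  - intros e e'; destruct (surjE e) as [s [x ->]], (surjE e') as [t [y ->]].
    rewrite !hom_src, !hom_tgt, !ohom_bang, ohom_wire; apply Hin.
  - intros e e'; destruct (surjE e) as [s [x ->]], (surjE e') as [t [y ->]].
    rewrite !hom_src, ohom_wire; apply Hout.
  - intros e e'; destruct (surjE e) as [s [x ->]], (surjE e') as [t [y ->]].
    rewrite !hom_src, !hom_tgt, ohom_bang; apply Hu.
  - intros x; destruct (surjV x) as [s [v ->]]; rewrite ohom_bang; intro Hv.
    apply adj_map, (bang_adj_refl HG Hv).
  - intros x y Hx Hy; destruct (surjV y) as [t [w ->]]; intros A A'.
    destruct (cover_adj Hx A) as [v [-> [Hv vw]]].
    destruct (cover_adj Hy A') as [w' [E [_ wv]]].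
    rewrite ohom_bang in Hy; exact (Ha t v w w' Hv Hy vw wv E).
  - intros x y z Hx Hy; destruct (surjV z) as [t [v ->]]; intros xy yz.
    (* Lifting from the far end backwards makes both edges land in the leg [t], composable at
       [c]. *)
    destruct (cover_adj Hy yz) as [c [-> [Hc cv]]].
    destruct (cover_adj Hx xy) as [d [-> [Hd dc]]].
    apply adj_map, (bang_adj_trans HG Hd Hc dc cv).
  - intros x e Hx; destruct (surjE e) as [t [y ->]].
    rewrite !hom_src, !hom_tgt, ohom_bang, ohom_wire; intros W N A.
    destruct (cover_adj Hx A) as [c [-> [Hc cv]]].
    apply adj_map, (open_in HG Hc W N cv).
  - intros x e Hx; destruct (surjE e) as [t [y ->]].
    rewrite !hom_src, !hom_tgt, ohom_wire; intros W A.
    destruct (cover_adj Hx A) as [c [-> [Hc cv]]].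
    apply adj_map, (open_out HG Hc W cv).
Qed.

End Cover.

(** * COPY *)

Section Copy.
Variables (G C : over G3) (b : vert G) (i j : ohom G C).
Hypothesis HG : pattern_axioms G.
Hypothesis Hb : is_bang b.
Hypothesis HC :
  is_pushout (sub_oincl (sub_compl (B b))) (sub_oincl (sub_compl (B b))) i j.

Let leg (s : bool) : ohom G C := if s then i else j.

Lemma leg_glueE s t e : ~ adj b (src e) -> ~ adj b (tgt e) -> onE (leg s) e = onE (leg t) e.
Proof.
  intros Ns Nt; pose proof (proj2 (proj1 HC) (exist _ e (conj Ns Nt))) as E.
  destruct s, t; simpl in *; congruence.
Qed.

Lemma leg_inv s t v w : onV (leg s) v = onV (leg t) w -> v = w /\ (s = t \/ ~ adj b v).
Proof.
  (* The two labels of [v] agree exactly when [v] lies outside [B b], so this labelling respects the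
     gluing and tells apart the two copies of a vertex of [B b]. *)
  set (inl' := fun v : vert G => (v, True)); set (inr' := fun v => (v, ~ adj b v)).
  intro E.
  assert (K : copair inl' inr' (if s then inl v else inr v) =
              copair inl' inr' (if t then inl w else inr w)).
  { apply (coequaliser_separates (X := osum G G) (pushout_coequaliser HC)
      (tau := fun p => onV (typ G) (fst p)) (h := copair inl' inr')).
    - intros [x | x]; reflexivity.
    - intros [x hx]; unfold inl', inr'; simpl in *; f_equal.
      apply propositional_extensionality; tauto.
    - destruct s, t; exact E. }
  pose proof (f_equal fst K) as E1; pose proof (f_equal snd K) as E2.
  destruct s, t; simpl in E1, E2; split; auto; right; [rewrite E1, <- E2 | rewrite E2]; exact I.
Qed.

Lemma leg_surjV v : exists s x, v = onV (leg s) x.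
Proof.
  destruct (proj1 (coequaliser_surj (pushout_coequaliser HC)) v) as [[x | x] Hx];
    [exists true, x | exists false, x]; exact Hx.
Qed.

Lemma leg_surjE e : exists s x, e = onE (leg s) x.
Proof.
  destruct (proj2 (coequaliser_surj (pushout_coequaliser HC)) e) as [[x | x] Hx];
    [exists true, x | exists false, x]; exact Hx.
Qed.

(** If the legs differ, the target lies outside [B b]; by transitivity so does the source, and the
    edge is shared by both copies. *)
Lemma leg_move s t e w : is_bang (src e) ->
  onV (leg s) (tgt e) = onV (leg t) w -> onE (leg s) e = onE (leg t) e.
Proof.
  intros He E; destruct (leg_inv E) as [_ [-> | N]]; [reflexivity |].
  apply leg_glueE; [| exact N]; intro A; apply N.
  apply (bang_adj_trans HG Hb He A); exists e; auto.
Qed.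

Lemma copy_pattern : pattern_axioms C.
Proof.
  apply (cover_pattern (f := leg) HG leg_surjV leg_surjE).
  - intros s t e w He E; exists (src e).
    rewrite <- (hom_src (leg s)), (leg_move He E), hom_src; split; [reflexivity |].
    exists e; destruct (leg_inv E); auto.
  - intros s t e e' W N N' E; destruct (leg_inv E) as [E' K].
    rewrite <- (wire_in_unique HG W N N' E').
    destruct K as [-> | K]; [reflexivity |].
    (* Openness in contrapositive form: a target outside [B b] forces the source outside, so the
       edge is shared. *)
    apply leg_glueE; [| exact K]; intro A; apply K, (open_in HG Hb W N A).
  - intros s t e e' W E; destruct (leg_inv E) as [E' K].
    rewrite <- (wire_out_unique HG W E').
    destruct K as [-> | K]; [reflexivity |].
    apply leg_glueE; [exact K |]; intro A; apply K, (open_out HG Hb W A).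
  - intros s t e e' He Es Et.
    rewrite (leg_move (src_bang He) Et); f_equal.
    apply (bang_edge_unique HG He); [apply (leg_inv Es) | apply (leg_inv Et)].
  - intros t v w w' Hv Hw vw wv E; destruct (leg_inv E) as [<- _]; f_equal.
    apply (bang_adj_antisym HG); assumption.
Qed.

End Copy.

(** * MERGE *)

Lemma mergeV_idem (G : over G3) (b b' v : vert G) :
  mergeV b b' (mergeV b b' v) = mergeV b b' v.
Proof. unfold mergeV; repeat destruct excluded_middle_informative; congruence. Qed.

Lemma adj_Bup (G : graph) (v b : vert G) : adj v b -> inV (Bup b) v.
Proof. intros [e [Es Et]]; exists e; auto. Qed.

Section Merge.
Variables (G M : over G3) (b b' : vert G).
Variables (phi : ohom (sub_over (Bup b)) (sub_over (Bup b'))) (q : ohom G M).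
Hypothesis HG : pattern_axioms G.
Hypotheses (Hb : is_bang b) (Hb' : is_bang b').
Hypothesis Hpred : sub_eq (del_vert (Bup b) b) (del_vert (Bup b') b').
Hypothesis Hdisj : sub_disjoint (B b) (B b').
Hypothesis Hphi : Bup_iso phi.
Hypothesis HM : is_coequaliser (sub_oincl (Bup b)) (ohom_comp (sub_oincl (Bup b')) phi) q.

(* Symmetric, so that [b] and [b'] need not be treated separately. *)
Definition merged (v w : vert G) : Prop := (v = b /\ w = b') \/ (v = b' /\ w = b).

Lemma phi_mergeV (v : vert (sub_over (Bup b))) :
  proj1_sig (onV phi v) = mergeV b b' (proj1_sig v).
Proof.
  destruct Hphi as [_ [P [Q _]]]; destruct (classic (proj1_sig v = b)) as [E | N].
  - rewrite E, mergeV_b; apply P, E.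
  - rewrite mergeV_ne by exact N; apply Q; split; [exact (proj2_sig v) | exact N].
Qed.

(** On vertices [phi] is [mergeV b b'], which is idempotent and so constant on each glued pair; its
    only nontrivial fibre can be that of [b] and [b']. *)
Lemma merge_sep v w : onV q v = onV q w -> v = w \/ merged v w.
Proof.
  intro E.
  assert (K : mergeV b b' v = mergeV b b' w).
  { revert E; apply (coequaliser_separates HM (tau := onV (typ G))).
    - intro x; unfold mergeV; destruct excluded_middle_informative as [-> |]; [| reflexivity].
      exact (eq_trans Hb' (eq_sym Hb)).
    - intro a; refine (eq_trans _ (f_equal (mergeV b b') (eq_sym (phi_mergeV a)))).
      symmetry; apply mergeV_idem. }
  unfold merged; revert K; unfold mergeV.
  destruct (excluded_middle_informative (v = b)), (excluded_middle_informative (w = b));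
    intuition congruence.
Qed.

Lemma merged_bang v w : merged v w -> is_bang v /\ is_bang w.
Proof. intros [[-> ->] | [-> ->]]; auto. Qed.

Lemma merged_disj v w x : merged v w -> adj v x -> adj w x -> False.
Proof.
  intros [[-> ->] | [-> ->]] A A'; apply (proj1 Hdisj x); split; assumption.
Qed.

(** The loop at [w] puts [w] in [B w], which is disjoint from [B v]. *)
Lemma merged_not_adj v w : merged v w -> ~ adj v w.
Proof.
  intros m A; apply (merged_disj m A), (bang_adj_refl HG), (merged_bang m).
Qed.

Lemma merged_pred v w x : merged v w -> adj x v -> x <> v -> adj x w.
Proof.
  intros [[-> ->] | [-> ->]] [e [Es Et]] N.
  - destruct (proj1 (proj1 Hpred x)) as [[f [Ft Fs]] _]; [| exists f; auto].
    split; [exists e; auto | exact N].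
  - destruct (proj2 (proj1 Hpred x)) as [[f [Ft Fs]] _]; [| exists f; auto].
    split; [exists e; auto | exact N].
Qed.

(** The edge [e] lies in [Bup b], so [q] glues it to its image under [phi], and uniqueness of edges
    between !-vertices shows that this image is [e']. *)
Lemma merge_edge e e' : tgt e = b -> tgt e' = b' ->
  onV q (src e) = onV q (src e') -> onE q e = onE q e'.
Proof.
  intros Et Et' E.
  assert (he : inE (Bup b) e).
  { split; [exists e; auto |].
    rewrite Et; apply adj_Bup, (bang_adj_refl HG Hb). }
  assert (K : forall f, src f = mergeV b b' (src e) -> tgt f = b' -> f = e').
  { intros f Fs Ft.
    apply (bang_edge_unique HG); [rewrite Ft; exact Hb' | rewrite Fs | congruence].
    (* Either the sources coincide and differ from [b], or both edges are loops, or [e] would run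
       from [b'] to [b], which is impossible. *)
    destruct (merge_sep E) as [E' | [[E1 E2] | [E1 E2]]].
    - rewrite <- E'; apply mergeV_ne; intro E1.
      apply (@merged_not_adj b b'); [left; auto | exists e'; split; congruence].
    - rewrite E1, E2; apply mergeV_b.
    - exfalso; apply (@merged_not_adj b' b); [right; auto | exists e; auto]. }
  set (x := exist _ e he : edge (sub_over (Bup b))).
  refine (eq_trans (proj2 (proj1 HM) x) (f_equal (onE q) (K _ _ _))).
  - exact (eq_trans (f_equal (@proj1_sig _ _) (hom_src phi x)) (phi_mergeV (src x))).
  - refine (eq_trans (f_equal (@proj1_sig _ _) (hom_tgt phi x)) _).
    refine (eq_trans (phi_mergeV (tgt x)) _); simpl; rewrite Et; apply mergeV_b.
Qed.

Lemma merge_pattern : pattern_axioms M.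
Proof.
  apply (cover_pattern (f := fun _ : unit => q) HG).
  - intro v; exists tt; apply (coequaliser_surj HM).
  - intro e; exists tt; apply (coequaliser_surj HM).
  - intros _ _ e w He E; destruct (merge_sep E) as [<- | m].
    { exists (src e); split; [reflexivity | exists e; auto]. }
    (* [merged_pred] does not apply to a loop, which is replaced by the loop at [w]. *)
    destruct (classic (src e = tgt e)) as [L | L].
    + exists w; split; [rewrite L; exact E | apply (bang_adj_refl HG), (merged_bang m)].
    + exists (src e); split; [reflexivity |].
      apply (merged_pred m); [exists e; auto | exact L].
  - intros _ _ e e' W N N' E; f_equal; apply (wire_in_unique HG); auto.
    destruct (merge_sep E) as [E' | m]; [exact E' |].
    destruct (wire_not_bang W); apply (merged_bang m).
  - intros _ _ e e' W E; f_equal; apply (wire_out_unique HG); auto.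
    destruct (merge_sep E) as [E' | m]; [exact E' |].
    destruct (wire_not_bang W); apply (merged_bang m).
  - intros _ _ e e' He Es Et.
    destruct (merge_sep Et) as [Et' | [[E1 E2] | [E1 E2]]].
    + f_equal; apply (bang_edge_unique HG He); [| exact Et'].
      (* Merged sources would put the common target in both [B b] and [B b']. *)
      destruct (merge_sep Es) as [Es' | m]; [exact Es' | exfalso].
      apply (merged_disj m (x := tgt e)); [exists e | exists e']; auto.
    + apply merge_edge; assumption.
    + symmetry; apply merge_edge; auto.
  - intros _ v w w' Hv Hw vw wv E; f_equal.
    destruct (merge_sep E) as [<- | m]; [apply (bang_adj_antisym HG); assumption |].
    (* The loop at [w] and the path from [w'] through [v] to [w] would put [w] in both of the
       disjoint [B w] and [B w']. *)
    exfalso; apply (merged_disj m (bang_adj_refl HG Hw)).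
    exact (bang_adj_trans HG (proj2 (merged_bang m)) Hv wv vw).
Qed.

End Merge.

Theorem theorem4p6 (G : over G3) (HG : pattern_graph G)
    (b : vert G) (Hb : is_bang b) :
  (forall C : over G3, is_COPY b C -> pattern_graph C) /\
  pattern_graph (DROP b) /\
  pattern_graph (KILL b) /\
  (forall b' : vert G, is_bang b' ->
     sub_eq (del_vert (Bup b) b) (del_vert (Bup b') b') ->
     sub_disjoint (B b) (B b') ->
     forall M : over G3, is_MERGE b b' M -> pattern_graph M).
Proof.
  split; [| split; [| split]].
  - intros C [i [j HC]]; apply pattern_graphP in HG; apply pattern_graphP.
    exact (copy_pattern HG Hb HC).
  - apply pattern_graph_full; [| exact HG].
    intros e [_ Hs] [_ Ht]; repeat split; assumption.
  - apply pattern_graph_full; [| exact HG]; intros e Hs Ht; split; assumption.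
  - intros b' Hb' Hpred Hdisj M [phi [q [Hphi HM]]].
    apply pattern_graphP in HG; apply pattern_graphP.
    exact (merge_pattern HG Hb Hb' Hpred Hdisj Hphi HM).
Qed.
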